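(* Let $q$ be a real-valued query with sensitivity $1$, and let $\mathcal M_q$ be the R$^2$DP Laplace mechanism whose random scale $b$ is such that $1/b$ has moment generating function $M(t)=\mathbb E[e^{t/b}]$. Then $\mathcal M_q$ satisfies $$\Big(\alpha,\ \tfrac{1}{\alpha-1}\log\Big[\tfrac{\alpha M(\alpha-1)+(\alpha-1)M(-\alpha)}{2\alpha-1}\Big]\Big)\text{-RDP if }\alpha>1,$$ and $(1,\ M'(0)+M(-1)-1)$-RDP if $\alpha=1$.
   Context: $\mathrm{Lap}(b)$ is the zero-mean Laplace distribution with density $\frac1{2b}e^{-|x|/b}$; the R$^2$DP Laplace mechanism draws the random scale $b$ (independently of the data) and adds $\mathrm{Lap}(b)$ noise to $q(d)$. Sensitivity is $\max|q(d)-q(d')|$ over datasets $d,d'$ differing in one individual's data. For distributions $P,Q$ with densities $p,q$ the Rényi divergence of order $\alpha>1$ is $D_\alpha(P\|Q)=\frac{1}{\alpha-1}\log\int p(x)^\alpha q(x)^{1-\alpha}dx$, and $D_1$ is the Kullback–Leibler divergence. A mechanism $\mathcal M$ satisfies $(\alpha,\epsilon)$-RDP (Rényi differential privacy) if $D_\alpha(\mathcal M(d)\|\mathcal M(d'))\le\epsilon$ for all adjacent $d,d'$. *)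

(* Defs.v *)
From HB Require Import structures.
From mathcomp Require Import all_boot all_order all_algebra.
From mathcomp Require Import all_classical all_reals all_analysis.
Set Implicit Arguments. Unset Strict Implicit. Unset Printing Implicit Defensive.
Import Order.TTheory GRing.Theory Num.Theory.
Import numFieldNormedType.Exports.
Local Open Scope classical_set_scope.
Local Open Scope ring_scope.

Section defs.
Variable R : realType.

Definition sensitivity (D : Type) (adj : D -> D -> Prop) (q : D -> R) : \bar R :=
  ereal_sup [set r : \bar R | exists d d', adj d d' /\ r = (`|q d - q d'|)%:E].

Definition r2dp_density d (T : measurableType d) (P : probability T R)
  (b : T -> R) (mu : R) (x : R) : R :=
  fine (\int[P]_w ((2 * b w)^-1 * expR (- (`|x - mu| / b w)))%:E)%E.

Definition renyi_div (alpha : R) (p q : R -> R) : \bar R :=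
  match (\int[@lebesgue_measure R]_x (p x `^ alpha * q x `^ (1 - alpha))%:E)%E with
  | r%:E => if (0 < r)%R then ((alpha - 1)^-1 * ln r)%R%:E else -oo
  | +oo%E => +oo
  | -oo%E => -oo
  end%E.

Definition kl_div (p q : R -> R) : \bar R :=
  (\int[@lebesgue_measure R]_x (p x * ln (p x / q x))%:E)%E.

Definition rdiv (alpha : R) (p q : R -> R) : \bar R :=
  if alpha == 1 then kl_div p q else renyi_div alpha p q.

(* (alpha, eps)-RDP of a mechanism given by its output density on each dataset. *)
Definition RDP (D : Type) (adj : D -> D -> Prop) (M : D -> R -> R)
  (alpha eps : R) : Prop :=
  forall d d', adj d d' -> (rdiv alpha (M d) (M d') <= eps%:E)%E.

End defs.

(* Main.v *)
Require Import Defs.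
From HB Require Import structures.
From mathcomp Require Import all_boot all_order all_algebra.
From mathcomp Require Import all_classical all_reals all_analysis.
From mathcomp Require Import ring lra measurable_realfun.
Import Order.TTheory GRing.Theory Num.Theory.
Import numFieldNormedType.Exports.
Local Open Scope classical_set_scope.
Local Open Scope ring_scope.

(* With r = 1/b, the output density at data point d is the mixture
   p_a(x) = E[(r/2) e^(-r|x-a|)], a = q(d).  The function u^al v^(1-al) is
   convex and homogeneous of degree one on positive reals, so integrating its
   tangent plane gives p_a^al p_c^(1-al) <= E[same expression at fixed r].  By
   Tonelli and an explicit integral at fixed r,
     int p_a^al p_c^(1-al) dx <= E[(al e^((al-1)rs) + (al-1) e^(-al rs)) / (2al-1)]
   with s = |a-c| <= 1, and the right-hand side is nondecreasing in s.

   The case al = 1 is a limit of the previous one: p ln(p/q) is at most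
   (p^al q^(1-al) - p)/(al-1) for every al > 1, so the divergence is bounded by
   [al (M(h)-1)/h + M(-al) - 1]/(2al-1) with h = al-1, where M(-al) <= M(-1);
   now let h decrease to 0. *)

Set Implicit Arguments.
Unset Strict Implicit.
Unset Printing Implicit Defensive.

(** * Tangent-line inequalities for the exponential *)

Lemma expR_tangent_le (R : realType) (s t : R) :
  expR s * (1 + (t - s)) <= expR t.
Proof.
rewrite -[in leRHS](subrK s t) [t - s + s]addrC expRD.
by rewrite ler_pM2l ?expR_gt0 ?expR_ge1Dx.
Qed.

(* The tangent plane of [(u, v) |-> u^al * v^(1 - al)] along the ray
   [u / v = expR L], at [u = expR A] and [v = expR B]; its negative term stands
   on the right so that both sides can be integrated as nonnegative functions. *)
Lemma expR_perspective_ge (R : realType) (al A B L : R) : 1 <= al ->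
  al * expR ((al - 1) * L + A) <=
  expR (al * A + (1 - al) * B) + (al - 1) * expR (al * L + B).
Proof.
move=> al1; set X := (al - 1) * L + A.
have h1 := @expR_tangent_le R X (al * A + (1 - al) * B).
have h2 := @expR_tangent_le R X (al * L + B).
have h3 : (al - 1) * (expR X * (1 + (al * L + B - X))) <=
          (al - 1) * expR (al * L + B) by apply: ler_wpM2l => //; lra.
(* The tangents at [X] are combined with weights 1 and [al - 1]; by the choice of [X] their
   first-order terms cancel. *)
have -> : al * expR X = expR X * (1 + (al * A + (1 - al) * B - X)) +
  (al - 1) * (expR X * (1 + (al * L + B - X))) by rewrite /X; ring.
exact: lerD.
Qed.

Lemma powR_expR (R : realType) (x y : R) : expR x `^ y = expR (y * x).
Proof. by rewrite /powR gt_eqF ?expR_gt0// expRK. Qed.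

(** With A = ln p and B = ln q, the power term is exp(A + (al - 1)(A - B)), and the bound is the
    tangent of exp at A. It serves to bound the integrand of the Kullback-Leibler divergence. *)
Lemma ln_ratio_le_powR (R : realType) (al p q : R) : 0 < p -> 0 < q ->
  (al - 1) * (p * ln (p / q)) <= p `^ al * q `^ (1 - al) - p.
Proof.
rewrite -!(posrE _) => p0 q0.
rewrite -(lnK p0) -(lnK q0) -expRN -expRD expRK !powR_expR -expRD.
set A := ln p; set B := ln q.
have := @expR_tangent_le R A (al * A + (1 - al) * B).
have -> : expR A * (1 + (al * A + (1 - al) * B - A)) =
  (al - 1) * (expR A * (A - B)) + expR A by ring.
by rewrite lerBrDr.
Qed.

(** The slope in s is al (al - 1) (exp((al - 1) s) - exp(- al s)), nonnegative for s >= 0. Adding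
    the tangent-line bounds at s of both exponentials produces exactly this slope times t - s. *)
Lemma renyi_laplace_nondecreasing (R : realType) (al s t : R) :
  1 <= al -> 0 <= s -> s <= t ->
  al * expR ((al - 1) * s) + (al - 1) * expR (- (al * s)) <=
  al * expR ((al - 1) * t) + (al - 1) * expR (- (al * t)).
Proof.
move=> al1 s0 st.
have h1 : al * (expR ((al - 1) * s) * (1 + ((al - 1) * t - (al - 1) * s))) <=
          al * expR ((al - 1) * t).
  by apply: ler_wpM2l; [lra|exact: expR_tangent_le].
have h2 : (al - 1) * (expR (- (al * s)) * (1 + (- (al * t) - - (al * s)))) <=
          (al - 1) * expR (- (al * t)).
  by apply: ler_wpM2l; [lra|exact: expR_tangent_le].
apply: le_trans (lerD h1 h2); rewrite -subr_ge0.
have -> : al * (expR ((al - 1) * s) * (1 + ((al - 1) * t - (al - 1) * s))) +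
  (al - 1) * (expR (- (al * s)) * (1 + (- (al * t) - - (al * s)))) -
  (al * expR ((al - 1) * s) + (al - 1) * expR (- (al * s))) =
  al * (al - 1) * (t - s) * (expR ((al - 1) * s) - expR (- (al * s))) by ring.
apply: mulr_ge0; first by apply: mulr_ge0; [apply: mulr_ge0; lra|lra].
by rewrite subr_ge0 ler_expR; nra.
Qed.

(** * Integrals of exponentials on half-lines and segments *)

Lemma is_derive_expR_affine (R : realType) (c k u x : R) :
  is_derive x 1 (fun y : R => c * expR (k * (y - u))) (c * (k * expR (k * (x - u)))).
Proof.
apply: is_derive_eq; rewrite /GRing.scale/= ?mulr1 ?mulr0 ?addr0 ?subr0; ring.
Qed.

Lemma continuous_expR_affine (R : realType) (c k u : R) :
  continuous (fun y : R => c * expR (k * (y - u))).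
Proof.
move=> x; apply: differentiable_continuous; apply/derivable1_diffP.
by have [] := @is_derive_expR_affine R c k u x.
Qed.

Lemma derive1_expR_affine (R : realType) (c k u : R) :
  (fun y : R => c * expR (k * (y - u)))^`()%classic =
  (fun x => c * (k * expR (k * (x - u)))).
Proof.
apply/funext => x; rewrite derive1E.
by have [_ ->] := @is_derive_expR_affine R c k u x.
Qed.

Lemma integral_expR_itvcy (R : realType) (k u v : R) : 0 < k ->
  (\int[lebesgue_measure]_(x in `[v, +oo[) (expR (- k * (x - u)))%:E =
   (expR (- k * (v - u)) / k)%:E)%E.
Proof.
move=> k0; rewrite (@ge0_continuous_FTC2y R _
  (fun x => - k^-1 * expR (- k * (x - u))) v 0).
- by rewrite sub0e -EFinN; congr EFin; ring.
- by move=> x _; exact: expR_ge0.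
- apply: continuous_subspaceT => x.
  have := @continuous_expR_affine R 1 (- k) u x.
  by under eq_fun do rewrite mul1r.
- rewrite -(mulr0 (- k^-1)); apply: cvgMl_tmp.
  under eq_fun do rewrite mulNr.
  apply: (cvg_comp (fun x => k * (x - u)) (fun z => expR (- z))).
    by apply: gt0_cvgMry => //; exact: cvg_addrr.
  exact: cvgr_expR.
- by move=> x _; have [] := @is_derive_expR_affine R (- k^-1) (- k) u x.
- by apply: cvg_at_right_filter; exact: continuous_expR_affine.
- move=> x _; rewrite derive1_expR_affine.
  by rewrite mulrA mulrNN mulVf ?gt_eqF// mul1r.
Qed.

(** The reflection x -> -x reduces this to the right half-line. *)
Lemma integral_expR_itvNyc (R : realType) (k u v : R) : 0 < k ->
  (\int[lebesgue_measure]_(x in `]-oo, v]) (expR (k * (x - u)))%:E =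
   (expR (k * (v - u)) / k)%:E)%E.
Proof.
move=> k0; rewrite -(opprK v) ge0_integration_by_substitutionNy/=.
- transitivity (\int[lebesgue_measure]_(x in `[(- v)%R, +oo[)
    (expR (- k * (x - (- u))))%:E)%E.
    by apply: eq_integral => x _; congr (expR _)%:E; ring.
  by rewrite integral_expR_itvcy//; congr (expR _ / _)%:E; ring.
- apply: continuous_subspaceT => x.
  have := @continuous_expR_affine R 1 k u x.
  by under eq_fun do rewrite mul1r.
- by move=> x _; exact: expR_ge0.
Qed.

Lemma integral_expR_itvcc (R : realType) (m u v : R) : m != 0 -> u <= v ->
  (\int[lebesgue_measure]_(x in `[u, v]) (expR (m * (x - u)))%:E =
   ((expR (m * (v - u)) - 1) / m)%:E)%E.
Proof.
(* For [u = v] both sides vanish; the fundamental theorem of calculus is applied with [u < v]. *)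
move=> m0; rewrite le_eqVlt => /predU1P[->|uv].
  by rewrite set_itv1 integral_set1 subrr mulr0 expR0 subrr mul0r.
rewrite (@continuous_FTC2 R _ (fun x => m^-1 * expR (m * (x - u))) u v)//.
- by rewrite subrr mulr0 expR0 -EFinB; congr EFin; ring.
- apply: continuous_subspaceT => x.
  have := @continuous_expR_affine R 1 m u x.
  by under eq_fun do rewrite mul1r.
- split=> [x _||].
  + by have [] := @is_derive_expR_affine R m^-1 m u x.
  + by apply: cvg_at_right_filter; exact: continuous_expR_affine.
  + by apply: cvg_at_left_filter; exact: continuous_expR_affine.
- by move=> x _; rewrite derive1_expR_affine mulrA mulVf// mul1r.
Qed.

Lemma integral_two_sided_expR (R : realType) (g : R -> R) (k m u v : R) :
  0 < k -> m != 0 -> u <= v -> measurable_fun setT g ->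
  (forall x, x <= u -> g x = expR (k * (x - u))) ->
  (forall x, u <= x <= v -> g x = expR (m * (x - u))) ->
  (forall x, v <= x -> g x = expR (m * (v - u)) * expR (- k * (x - v))) ->
  (\int[lebesgue_measure]_x (g x)%:E =
   (k^-1 + (expR (m * (v - u)) - 1) / m + expR (m * (v - u)) / k)%:E)%E.
Proof.
move=> k0 m0 uv mg gl gm gr.
have mgE (D : set R) : measurable_fun D (EFin \o g).
  by apply/measurable_EFinP; exact: measurable_funTS.
have g0 x : (0 <= (g x)%:E)%E.
  rewrite lee_fin; have [xu|/ltW ux] := leP x u; first by rewrite gl// expR_ge0.
  have [xv|/ltW vx] := leP x v; first by rewrite gm ?ux// expR_ge0.
  by rewrite gr// mulr_ge0// expR_ge0.
have -> : [set: R] = `]-oo, u] `|` `]u, +oo[.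
  by rewrite -itv_bndbnd_setU// set_itvE.
rewrite ge0_integral_setU//=; last 2 first.
- exact: mgE.
- apply/disj_set2P; rewrite -subset0 => x [] /=; rewrite !in_itv/= andbT => xu.
  by rewrite ltNge xu.
rewrite integral_itv_obnd_cbnd; last exact: mgE.
have -> : `[u, +oo[%classic = `[u, v] `|` `]v, +oo[ :> set R.
  by rewrite -itv_bndbnd_setU// bnd_simp.
rewrite ge0_integral_setU//=; last 2 first.
- exact: mgE.
- apply/disj_set2P; rewrite -subset0 => x [] /=; rewrite !in_itv/= andbT.
  by move=> /andP[_ xv]; rewrite ltNge xv.
rewrite integral_itv_obnd_cbnd; last exact: mgE.
have -> : (\int[lebesgue_measure]_(x in `]-oo, u]) (g x)%:E = (k^-1)%:E)%E.
  transitivity (\int[lebesgue_measure]_(x in `]-oo, u])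
    (expR (k * (x - u)))%:E)%E.
    by apply: eq_integral => x; rewrite inE/= in_itv/= => xu; rewrite gl.
  by rewrite integral_expR_itvNyc// subrr mulr0 expR0 mul1r.
have -> : (\int[lebesgue_measure]_(x in `[u, v]) (g x)%:E =
           ((expR (m * (v - u)) - 1) / m)%:E)%E.
  rewrite -integral_expR_itvcc//.
  by apply: eq_integral => x; rewrite inE/= in_itv/= => xu; rewrite gm.
have -> : (\int[lebesgue_measure]_(x in `[v, +oo[) (g x)%:E =
           (expR (m * (v - u)) / k)%:E)%E.
  transitivity (\int[lebesgue_measure]_(x in `[v, +oo[)
    ((expR (m * (v - u)))%:E * (expR (- k * (x - v)))%:E))%E.
    by apply: eq_integral => x; rewrite inE/= in_itv/= andbT => xv; rewrite gr.
  rewrite ge0_integralZl//=.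
  - rewrite integral_expR_itvcy// subrr mulr0 expR0 mul1r.
    by rewrite -EFinM.
  - apply/measurable_EFinP/measurable_funTS/measurableT_comp => //.
    by apply: measurable_funM => //; apply: measurable_funB.
by rewrite -!EFinD addrA.
Qed.

(** * Laplace densities at a fixed inverse scale r *)

Definition laplace_pdf {R : realType} (r a x : R) : R :=
  r / 2 * expR (- (r * `|x - a|)).

Lemma laplace_pdf_gt0 (R : realType) (r a x : R) :
  0 < r -> 0 < laplace_pdf r a x.
Proof. by move=> r0; rewrite mulr_gt0 ?expR_gt0// divr_gt0. Qed.

Lemma laplace_pdf_expR (R : realType) (r a x : R) : 0 < r ->
  laplace_pdf r a x = expR (ln (r / 2) - r * `|x - a|).
Proof. by move=> r0; rewrite expRD lnK// posrE divr_gt0. Qed.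

Lemma measurable_laplace_pdf d (T : measurableType d) (R : realType)
    (r y : T -> R) (a : R) :
  measurable_fun setT r -> measurable_fun setT y ->
  measurable_fun setT (fun t => laplace_pdf (r t) a (y t)).
Proof.
move=> mr my; apply: measurable_funM; first exact: measurable_funM.
apply: measurableT_comp => //; apply: measurableT_comp => //.
apply: measurable_funM => //; apply: measurableT_comp => //.
exact: measurable_funB.
Qed.

(** The logarithm of the integrand is piecewise affine with kinks at a and c: slope r before both,
    -r after both, and (2 al - 1) r in absolute value between them. *)
Lemma integral_laplace_pdf_powR (R : realType) (r al a c : R) :
  0 < r -> 1 <= al ->
  (\int[lebesgue_measure]_x
     (laplace_pdf r a x `^ al * laplace_pdf r c x `^ (1 - al))%:E =
  ((al * expR ((al - 1) * (r * `|a - c|)) +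
    (al - 1) * expR (- (al * (r * `|a - c|)))) / (2 * al - 1))%:E)%E.
Proof.
move=> r0 al1.
pose s := `|a - c|.
pose h x := expR (- (al * r * `|x - a|) + (al - 1) * (r * `|x - c|)).
have gE x : laplace_pdf r a x `^ al * laplace_pdf r c x `^ (1 - al) =
            r / 2 * h x.
  rewrite !laplace_pdf_expR// !powR_expR -expRD /h.
  rewrite -[r / 2]lnK ?posrE ?divr_gt0// -expRD; congr expR.
  rewrite expRK; ring.
have mh : measurable_fun setT h.
  apply: measurableT_comp => //; apply: measurable_funD.
    apply: measurableT_comp => //; apply: measurable_funM => //.
    by apply: measurableT_comp => //; exact: measurable_funB.
  do 2 apply: measurable_funM => //.
  by apply: measurableT_comp => //; exact: measurable_funB.
(* [X] and [Y] are the values of [h] at [a] and at [c]; dividing [h] by its value at the left centre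
   gives the normalised profile. *)
pose X := expR ((al - 1) * (r * s)).
pose Y := expR (- (al * (r * s))).
have hX0 : X != 0 by rewrite gt_eqF ?expR_gt0.
have hY0 : Y != 0 by rewrite gt_eqF ?expR_gt0.
have r00 : r != 0 by rewrite gt_eqF.
have al0 : 2 * al - 1 != 0 by rewrite gt_eqF//; lra.
suff : (\int[lebesgue_measure]_x (h x)%:E =
       (2 / r * ((al * X + (al - 1) * Y) / (2 * al - 1)))%:E)%E.
  move=> hE; under eq_integral do rewrite gE EFinM.
  rewrite ge0_integralZl//=.
  - rewrite hE -EFinM; congr EFin.
    by rewrite /X /Y /s; field; rewrite ?al0 ?r00.
  - exact/measurable_EFinP.
  - by move=> x _; rewrite lee_fin expR_ge0.
  - by rewrite lee_fin divr_ge0// ltW.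
(* Between the centres the slope is -(2 al - 1) r if a comes first and (2 al - 1) r if c does. *)
have [ac|/ltW ca] := leP a c.
  have sE : s = c - a by rewrite /s distrC ger0_norm ?subr_ge0.
  transitivity (\int[lebesgue_measure]_x (X%:E * (X^-1 * h x)%:E))%E.
    by apply: eq_integral => x _; rewrite -EFinM mulrA divff// mul1r.
  rewrite ge0_integralZl//=; last 3 first.
  - by apply/measurable_EFinP; exact: measurable_funM.
  - by move=> x _; rewrite lee_fin mulr_ge0 ?invr_ge0 ?expR_ge0.
  - by rewrite lee_fin expR_ge0.
  rewrite (@integral_two_sided_expR R _ r (- ((2 * al - 1) * r)) a c)//.
  - have -> : expR (- ((2 * al - 1) * r) * (c - a)) = Y / X.
      by rewrite /X /Y -expRN -expRD sE; congr expR; ring.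
    rewrite -EFinM; congr EFin; field.
    by rewrite ?al0 ?r00 ?hX0 ?oppr_eq0 ?mulf_neq0.
  - by rewrite oppr_eq0 mulf_neq0.
  - exact: measurable_funM.
  - move=> x xa; rewrite /h /X -expRN -expRD sE; congr expR.
    rewrite !ler0_norm; [ring|lra|lra].
  - move=> x /andP[ax xc]; rewrite /h /X -expRN -expRD sE; congr expR.
    rewrite ger0_norm ?ler0_norm; [ring|lra|lra].
  - move=> x cx; rewrite /h /X -expRN -!expRD sE; congr expR.
    rewrite !ger0_norm; [ring|lra|lra].
have sE : s = a - c by rewrite /s ger0_norm ?subr_ge0.
transitivity (\int[lebesgue_measure]_x (Y%:E * (Y^-1 * h x)%:E))%E.
  by apply: eq_integral => x _; rewrite -EFinM mulrA divff// mul1r.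
rewrite ge0_integralZl//=; last 3 first.
- by apply/measurable_EFinP; exact: measurable_funM.
- by move=> x _; rewrite lee_fin mulr_ge0 ?invr_ge0 ?expR_ge0.
- by rewrite lee_fin expR_ge0.
rewrite (@integral_two_sided_expR R _ r ((2 * al - 1) * r) c a)//.
- have -> : expR ((2 * al - 1) * r * (a - c)) = X / Y.
    by rewrite /X /Y -expRN -expRD sE; congr expR; ring.
  rewrite -EFinM; congr EFin; field.
  by rewrite ?al0 ?r00 ?hY0 ?mulf_neq0.
- by rewrite mulf_neq0.
- exact: measurable_funM.
- move=> x xa; rewrite /h /Y -expRN -expRD sE; congr expR.
  rewrite !ler0_norm; [ring|lra|lra].
- move=> x /andP[ax xc]; rewrite /h /Y -expRN -expRD sE; congr expR.
  rewrite ler0_norm ?ger0_norm; [ring|lra|lra].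
- move=> x cx; rewrite /h /Y -expRN -!expRD sE; congr expR.
  rewrite !ger0_norm; [ring|lra|lra].
Qed.

(** * Monotonicity and a Jensen inequality for integrals *)

(** Positive and negative parts are compared separately, so that integrands not known to be
    integrable, such as p ln(p/q), are covered. *)
Lemma le_integral_measurable d (T : measurableType d) (R : realType)
    (mu : {measure set T -> \bar R}) (f g : T -> \bar R) :
  measurable_fun setT f -> measurable_fun setT g ->
  (forall x, f x <= g x)%E ->
  (\int[mu]_x f x <= \int[mu]_x g x)%E.
Proof.
move=> mf mg fg; rewrite integralE [leRHS]integralE.
apply: leeB; apply: ge0_le_integral => //; try exact: measurable_funepos;
  try exact: measurable_funeneg => // x _.
- by move=> x _; apply: funepos_le (in_setT x) => y _.
- by move=> x _; apply: funeneg_le (in_setT x) => y _.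
Qed.

(** Jensen's inequality for u^al v^(1-al): its tangent plane at (p, q) lies below it, and
    integrating the plane returns its value at (p, q). By homogeneity the plane has no constant
    term, so the total mass of [mu] does not enter. *)
Lemma powR_integral_le d (T : measurableType d) (R : realType)
    (mu : {measure set T -> \bar R}) (U V : T -> R) (al p q : R) :
  1 <= al -> measurable_fun setT U -> measurable_fun setT V ->
  (forall w, 0 < U w) -> (forall w, 0 < V w) -> 0 < p -> 0 < q ->
  (\int[mu]_w (U w)%:E = p%:E)%E -> (\int[mu]_w (V w)%:E = q%:E)%E ->
  ((p `^ al * q `^ (1 - al))%:E <=
   \int[mu]_w (U w `^ al * V w `^ (1 - al))%:E)%E.
Proof.
move=> al1 mU mV U0 V0 p0 q0 Up Vq.
pose L := ln p - ln q.
(* [cu] and [- cv] are the partial derivatives of u^al v^(1-al) at (p, q), where p / q = exp L. *)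
pose cu := al * expR ((al - 1) * L).
pose cv := (al - 1) * expR (al * L).
have cu0 : 0 <= cu by rewrite mulr_ge0 ?expR_ge0//; lra.
have cv0 : 0 <= cv by rewrite mulr_ge0 ?expR_ge0//; lra.
have mUV : measurable_fun setT (fun w => U w `^ al * V w `^ (1 - al)).
  by apply: measurable_funM;
    [exact: (measurableT_comp (measurable_powR al) mU)|
     exact: (measurableT_comp (measurable_powR (1 - al)) mV)].
have UV0 w : 0 <= U w `^ al * V w `^ (1 - al) by rewrite mulr_ge0 ?powR_ge0.
have -> : p `^ al * q `^ (1 - al) = cu * p - cv * q.
  rewrite -(lnK (x := p)) ?posrE// -(lnK (x := q)) ?posrE// !powR_expR -expRD.
  rewrite /cu /cv -!mulrA -!expRD /L.
  have -> : (al - 1) * (ln p - ln q) + ln p = al * ln p + (1 - al) * ln q by ring.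
  have -> : al * (ln p - ln q) + ln q = al * ln p + (1 - al) * ln q by ring.
  ring.
(* The negative term moves to the right, leaving only integrals of nonnegative functions. *)
rewrite EFinB leeBlDr// !EFinM -Up -Vq -!ge0_integralZl//; last first.
all: try (by move=> w _; rewrite lee_fin ltW).
all: try exact/measurable_EFinP.
rewrite -ge0_integralD//=; last first.
all: try (by move=> w _; rewrite -?EFinM lee_fin// mulr_ge0// ltW).
all: try (by apply/measurable_EFinP => //; exact: measurable_funM).
apply: ge0_le_integral => //=.
- by move=> w _; rewrite lee_fin mulr_ge0// ltW.
- by apply/measurable_EFinP; exact: measurable_funM.
- by apply/measurable_EFinP; apply: measurable_funD => //; exact: measurable_funM.
- move=> w _; rewrite -EFinD lee_fin.
  have := @expR_perspective_ge R al (ln (U w)) (ln (V w)) L al1.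
  by rewrite !expRD -!powR_expR !lnK ?posrE// /cu /cv !mulrA.
Qed.

(** * Mixtures of Laplace densities over a random inverse scale *)

Section laplace_mixture.
Context d (T : measurableType d) (R : realType) (P : probability T R).
Variable r : T -> R.
Hypothesis mr : measurable_fun setT r.
Hypothesis r0 : forall w, 0 < r w.
Hypothesis ir : P.-integrable setT (EFin \o r).

(** [fine] would turn an infinite value into 0; integrability of [r] rules this out. *)
Definition laplace_mixture (a x : R) : R :=
  fine (\int[P]_w (laplace_pdf (r w) a x)%:E)%E.

Let mix := laplace_mixture.

Let measurable_laplace (a x : R) :
  measurable_fun setT (fun w => laplace_pdf (r w) a x).
Proof. by apply: measurable_laplace_pdf. Qed.

(** The density never exceeds r / 2, hence not r, which is integrable. *)
Lemma integrable_laplace_mixture (a x : R) :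
  P.-integrable setT (fun w => (laplace_pdf (r w) a x)%:E).
Proof.
apply: le_integrable ir => //; first exact/measurable_EFinP.
move=> w _ /=; rewrite lee_fin !gtr0_norm ?laplace_pdf_gt0//.
have : laplace_pdf (r w) a x <= r w / 2 * 1.
  apply: ler_wpM2l; first by rewrite divr_ge0// ltW.
  by rewrite -expR0 ler_expR oppr_le0 mulr_ge0// ltW.
by move/le_trans; apply; have := r0 w; lra.
Qed.

Lemma laplace_mixtureE (a x : R) :
  (\int[P]_w (laplace_pdf (r w) a x)%:E = (mix a x)%:E)%E.
Proof.
rewrite /mix /laplace_mixture fineK//.
exact: integrable_fin_num (integrable_laplace_mixture a x).
Qed.

(** A zero integral would make the density vanish almost everywhere; as it is positive everywhere,
    the exceptional set would be the whole space, of mass 1. *)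
Lemma laplace_mixture_gt0 (a x : R) : 0 < mix a x.
Proof.
rewrite lt_neqAle -!lee_fin -laplace_mixtureE integral_ge0 ?andbT; last first.
  by move=> w _; rewrite lee_fin ltW// laplace_pdf_gt0.
apply/negP => /eqP mix0.
have /ae_eq_integral_abs : (\int[P]_(w in setT) `|(laplace_pdf (r w) a x)%:E| = 0)%E.
  under eq_integral do rewrite gee0_abs ?lee_fin ?ltW ?laplace_pdf_gt0//.
  by rewrite laplace_mixtureE -mix0.
move=> /(_ measurableT); case; first exact/measurable_EFinP.
move=> N [mN PN0 subN].
have NT : N = setT.
  apply/seteqP; split => // w _; apply: subN => /(_ Logic.I) /eqP.
  by rewrite eqe gt_eqF// laplace_pdf_gt0.
have : (1 = 0 :> \bar R)%E by rewrite -(probability_setT P) -NT.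
by move=> /eqP; rewrite onee_eq0.
Qed.

Let measurable_joint (a : R) :
  measurable_fun setT (fun wx : T * R => laplace_pdf (r wx.1) a wx.2).
Proof.
by apply: measurable_laplace_pdf => //; exact: measurableT_comp mr measurable_fst.
Qed.

Lemma measurable_laplace_mixture (a : R) : measurable_fun setT (mix a).
Proof.
apply/measurable_EFinP.
rewrite (_ : _ \o _ = fun x => \int[P]_w (laplace_pdf (r w) a x)%:E)%E.
  apply: (measurable_fun_fubini_tonelli_G
    (fun wx : T * R => (laplace_pdf (r wx.1) a wx.2)%:E)).
    exact/measurable_EFinP.
  by move=> wx; rewrite lee_fin ltW// laplace_pdf_gt0.
by apply/funext => x; rewrite laplace_mixtureE.
Qed.

(** The integral of p^al q^(1-al) for Laplace densities of inverse scale r whose centres are at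
    distance s / r. *)
Definition laplace_renyi_moment (al s : R) : R :=
  (al * expR ((al - 1) * s) + (al - 1) * expR (- (al * s))) / (2 * al - 1).

Lemma integral_powR_joint (al a c : R) : 1 <= al ->
  (\int[lebesgue_measure]_x \int[P]_w
     (laplace_pdf (r w) a x `^ al * laplace_pdf (r w) c x `^ (1 - al))%:E =
   \int[P]_w (laplace_renyi_moment al (r w * `|a - c|))%:E)%E.
Proof.
move=> al1.
rewrite -(fubini_tonelli (m1 := P) (m2 := lebesgue_measure)
  (fun wx : T * R => (laplace_pdf (r wx.1) a wx.2 `^ al *
     laplace_pdf (r wx.1) c wx.2 `^ (1 - al))%:E)).
- by apply: eq_integral => w _; rewrite /= integral_laplace_pdf_powR.
- apply/measurable_EFinP; apply: measurable_funM.
    exact: (measurableT_comp (measurable_powR al) (measurable_joint a)).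
  exact: (measurableT_comp (measurable_powR (1 - al)) (measurable_joint c)).
- by move=> wx; rewrite lee_fin mulr_ge0 ?powR_ge0.
Qed.

(** The case [al = 1], [c = a] of [integral_powR_joint], where the moment is constantly 1. *)
Lemma integral_laplace_mixture (a : R) :
  (\int[lebesgue_measure]_x (mix a x)%:E = 1)%E.
Proof.
transitivity (\int[lebesgue_measure]_x \int[P]_w
     (laplace_pdf (r w) a x `^ 1 * laplace_pdf (r w) a x `^ (1 - 1))%:E)%E.
  apply: eq_integral => x _; rewrite -laplace_mixtureE.
  apply: eq_integral => w _.
  by rewrite subrr powRr0 mulr1 powRr1// ltW// laplace_pdf_gt0.
rewrite integral_powR_joint//; transitivity (\int[P]_w (cst 1%E w))%E.
  apply: eq_integral => w _; rewrite /laplace_renyi_moment subrr !mul0r expR0 addr0.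
  by rewrite (_ : 2 * 1 - 1 = 1) ?divr1 ?mulr1//; ring.
by rewrite integral_cst//= mul1e; exact: probability_setT.
Qed.

Lemma integral_powR_laplace_mixture_le (al a c : R) :
  1 <= al -> `|a - c| <= 1 ->
  (\int[lebesgue_measure]_x (mix a x `^ al * mix c x `^ (1 - al))%:E <=
   \int[P]_w (laplace_renyi_moment al (r w))%:E)%E.
Proof.
move=> al1 ac.
have mm s : measurable_fun setT (fun w => laplace_renyi_moment al (r w * s)).
  apply: measurable_funM => //; apply: measurable_funD; apply: measurable_funM => //;
    apply: measurableT_comp => //.
    by apply: measurable_funM => //; exact: measurable_funM.
  apply: measurableT_comp => //.
  by apply: measurable_funM => //; exact: measurable_funM.
have m0 s : 0 <= laplace_renyi_moment al s.
  apply: divr_ge0; last lra.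
  by apply: addr_ge0; apply: mulr_ge0; rewrite ?expR_ge0//; lra.
(* The intermediate bound keeps the true distance [|a - c|]; raising it to 1 is monotonicity in s at
   each fixed inverse scale. *)
apply: (@le_trans _ _ (\int[P]_w (laplace_renyi_moment al (r w * `|a - c|))%:E)%E);
  last first.
  apply: ge0_le_integral => //.
  - by move=> w _; rewrite lee_fin.
  - exact/measurable_EFinP.
  - apply/measurable_EFinP; have := mm 1.
    by under eq_fun do rewrite mulr1.
  - move=> w _; rewrite lee_fin ler_wpM2r ?invr_ge0//; first by lra.
    apply: renyi_laplace_nondecreasing => //.
      by rewrite mulr_ge0// ltW.
    by rewrite -[leRHS]mulr1 ler_wpM2l// ltW.
(* With the integrals exchanged, it suffices to apply Jensen's inequality at each [x]. *)
rewrite -integral_powR_joint//.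
apply: le_integral_measurable.
- apply/measurable_EFinP; apply: measurable_funM.
    exact: (measurableT_comp (measurable_powR al) (measurable_laplace_mixture a)).
  exact: (measurableT_comp (measurable_powR (1 - al)) (measurable_laplace_mixture c)).
- apply: (measurable_fun_fubini_tonelli_G
    (fun wx : T * R => (laplace_pdf (r wx.1) a wx.2 `^ al *
     laplace_pdf (r wx.1) c wx.2 `^ (1 - al))%:E)).
    apply/measurable_EFinP; apply: measurable_funM.
      exact: (measurableT_comp (measurable_powR al) (measurable_joint a)).
    exact: (measurableT_comp (measurable_powR (1 - al)) (measurable_joint c)).
  by move=> wx; rewrite lee_fin mulr_ge0 ?powR_ge0.
- move=> x; apply: powR_integral_le => //; try exact: laplace_mixture_gt0;
    try exact: laplace_mixtureE; by move=> w; exact: laplace_pdf_gt0.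
Qed.

(** The bound of [ln_ratio_le_powR] is integrated, with 1 written as the integral of [mix a];
    finiteness of the power integral lets the integral of the difference split. *)
Lemma kl_div_laplace_mixture_le (al a c : R) : 1 < al ->
  (\int[lebesgue_measure]_x (mix a x `^ al * mix c x `^ (1 - al))%:E < +oo)%E ->
  (kl_div (mix a) (mix c) <= (al - 1)^-1%:E *
    (\int[lebesgue_measure]_x (mix a x `^ al * mix c x `^ (1 - al))%:E - 1))%E.
Proof.
move=> al1 fin; rewrite -(integral_laplace_mixture a).
have ma := measurable_laplace_mixture a; have mc := measurable_laplace_mixture c.
have mac : measurable_fun setT (fun x => mix a x `^ al * mix c x `^ (1 - al)).
  apply: measurable_funM.
    exact: (measurableT_comp (measurable_powR al) ma).
  exact: (measurableT_comp (measurable_powR (1 - al)) mc).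
have ia : (@lebesgue_measure R).-integrable setT (fun x => (mix a x)%:E).
  apply/integrableP; split; first exact/measurable_EFinP.
  under eq_integral do rewrite gee0_abs ?lee_fin ?ltW ?laplace_mixture_gt0//.
  by rewrite integral_laplace_mixture ltry.
have iac : (@lebesgue_measure R).-integrable setT
    (fun x => (mix a x `^ al * mix c x `^ (1 - al))%:E).
  apply/integrableP; split; first exact/measurable_EFinP.
  by under eq_integral do rewrite gee0_abs ?lee_fin ?mulr_ge0 ?powR_ge0//.
rewrite -integralB// -integralZl//; last exact: integrableB.
apply: le_integral_measurable.
- apply/measurable_EFinP; apply: measurable_funM => //.
  apply: (measurableT_comp (@measurable_ln R)).
  rewrite (_ : (fun _ => _) = (fun x => mix a x * mix c x `^ (-1))).
    apply: measurable_funM => //.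
    exact: (measurableT_comp (measurable_powR (- 1)) mc).
  apply/funext => x; rewrite powR_inv1//.
  by rewrite ltW// laplace_mixture_gt0.
- apply/measurable_EFinP => //; apply: measurable_funM => //.
  exact: measurable_funB.
- move=> x; rewrite -EFinB -EFinM lee_fin ler_pdivlMl ?subr_gt0//.
  by apply: ln_ratio_le_powR; exact: laplace_mixture_gt0.
Qed.

End laplace_mixture.

(** * Moment generating function of a positive random variable *)

Section mmt_gen_nonneg.
Context d (T : measurableType d) (R : realType) (P : probability T R).
Variable r : T -> R.
Hypothesis mr : measurable_fun setT r.
Hypothesis r0 : forall w, 0 < r w.

Lemma mmt_gen_fun_integral (t : R) :
  ('M_P r t = \int[P]_w (expR (t * r w))%:E)%E.
Proof.
rewrite /mmt_gen_fun unlock; apply: eq_integral => w _ /=.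
by rewrite mulrC.
Qed.

Let measurable_expM (t : R) : measurable_fun setT (fun w => expR (t * r w)).
Proof. by apply: measurableT_comp => //; exact: measurable_funM. Qed.

(** Since r > 0, exp(s r) <= exp(t r): integrability passes to smaller arguments. *)
Lemma integrable_expR_le (s t : R) : s <= t ->
  P.-integrable setT (fun w => (expR (t * r w))%:E) ->
  P.-integrable setT (fun w => (expR (s * r w))%:E).
Proof.
move=> st it; apply: le_integrable it => //; first exact/measurable_EFinP.
by move=> w _; rewrite /= lee_fin !ger0_norm ?expR_ge0// ler_expR ler_wpM2r// ltW.
Qed.

Lemma integrable_expR0 : P.-integrable setT (fun w => (expR (0 * r w))%:E).
Proof.
under eq_fun do rewrite mul0r expR0.
exact: finite_measure_integrable_cst.
Qed.

Lemma mmt_gen_funE (t : R) :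
  P.-integrable setT (fun w => (expR (t * r w))%:E) ->
  ((fine ('M_P r t))%:E = \int[P]_w (expR (t * r w))%:E)%E.
Proof.
by move=> it; rewrite mmt_gen_fun_integral fineK//; exact: integrable_fin_num it.
Qed.

Lemma mmt_gen_fun_le (s t : R) : s <= t ->
  P.-integrable setT (fun w => (expR (t * r w))%:E) ->
  fine ('M_P r s) <= fine ('M_P r t).
Proof.
move=> st it; have is_ := integrable_expR_le st it.
rewrite -lee_fin !mmt_gen_funE//; apply: le_integral => // w _.
by rewrite lee_fin ler_expR ler_wpM2r// ltW.
Qed.

Lemma mmt_gen_fun0 : fine ('M_P r 0) = 1.
Proof.
apply: EFin_inj; rewrite (mmt_gen_funE integrable_expR0).
transitivity (\int[P]_w (cst 1%E w))%E.
  by apply: eq_integral => w _; rewrite mul0r expR0.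
by rewrite integral_cst//= mul1e; exact: probability_setT.
Qed.

Lemma integral_laplace_renyi_moment (al : R) : 1 <= al ->
  P.-integrable setT (fun w => (expR ((al - 1) * r w))%:E) ->
  (\int[P]_w (laplace_renyi_moment al (r w))%:E =
   ((al * fine ('M_P r (al - 1)) + (al - 1) * fine ('M_P r (- al)))
     / (2 * al - 1))%:E)%E.
Proof.
move=> al1 i1.
(* As [- al <= al - 1], the second exponential is dominated by the first. *)
have i2 : P.-integrable setT (fun w => (expR (- al * r w))%:E).
  by apply: integrable_expR_le i1; lra.
rewrite mulrC EFinM EFinD !EFinM !mmt_gen_funE//.
rewrite -!integralZl//= -integralD//=; try exact: integrableZl.
rewrite -integralZl//; last by apply: integrableD => //; exact: integrableZl.
apply: eq_integral => w _; rewrite /= /laplace_renyi_moment -!EFinM -?EFinD -?EFinM.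
by rewrite mulrC mulNr.
Qed.

Variable e : R.
Hypothesis e0 : 0 < e.
Hypothesis ie : forall t, `|t| < e ->
  P.-integrable setT (fun w => (expR (t * r w))%:E).

(** Dominates r exp(t r) for t < e / 4: by x <= exp x, r is at most 4 / e times one factor exp(e r /
    4), and the other such factor bounds exp(t r). *)
Let G (w : T) : R := 4 / e * expR (e / 2 * r w).

Let iG : P.-integrable setT (EFin \o G).
Proof.
rewrite (_ : _ \o _ = fun w => ((4 / e)%:E * (expR (e / 2 * r w))%:E)%E).
  have e2 : 0 <= e / 2 < e by apply/andP; split; move: e0; lra.
  by apply: integrableZl => //; apply: ie; case/andP: e2 => ? ?; rewrite ger0_norm.
by apply/funext => w; rewrite /= EFinM.
Qed.

Let G_bound (t : R) (w : T) : t < e / 4 -> r w * expR (t * r w) <= G w.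
Proof.
move=> te; rewrite /G.
have -> : e / 2 * r w = e / 4 * r w + e / 4 * r w by field.
rewrite expRD mulrA; apply: ler_pM.
- exact: ltW.
- exact: expR_ge0.
- rewrite -[4 / e]invf_div ler_pdivlMl ?divr_gt0//.
  by have := @expR_ge1Dx R (e / 4 * r w); lra.
- by rewrite ler_expR ler_wpM2r ?ltW.
Qed.

Lemma mmt_gen_integrable : P.-integrable setT (EFin \o r).
Proof.
apply: le_integrable iG => //; first exact/measurable_EFinP.
move=> w _; rewrite /= lee_fin !gtr0_norm//; last by rewrite mulr_gt0 ?expR_gt0// divr_gt0.
have : 0 < e / 4 by rewrite divr_gt0.
by move=> /(@G_bound 0 w); rewrite mul0r expR0 mulr1.
Qed.

(** Differentiation under the integral sign, dominated by [G] on (-e/4, e/4), makes the difference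
    quotient at 0 converge; the limit is then restricted to h > 0. *)
Lemma cvg_mmt_gen_quotient :
  h^-1 * (fine ('M_P r h) - 1) @[h --> 0^'+] -->
    (fun t => fine ('M_P r t))^`()%classic 0.
Proof.
pose M t := fine ('M_P r t).
have ME : M = fun t => \int[P]_(w in setT) expR (t * r w).
  by apply/funext => t; rewrite /M mmt_gen_fun_integral.
have dexp (t : R) (w : T) : is_derive t 1 (fun y => expR (y * r w)) (r w * expR (t * r w)).
  by apply: is_derive_eq; rewrite /GRing.scale/= ?mulr1 ?mulr0 ?addr0 ?add0r mulrC.
have I0 : `](- (e / 4)), (e / 4)[%classic (0 : R).
  by rewrite /= in_itv/=; apply/andP; split; move: e0; lra.
have cM : h^-1 *: (M (h + 0) - M 0) @[h --> 0^'] -->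
    \int[P]_(w in setT) partial1of2 (fun t w => expR (t * r w)) 0 w.
  rewrite ME; apply: (@cvg_differentiation_under_integral R _ T P _ _ measurableT
    0 (- (e / 4)) (e / 4) I0 _ _ G).
  - move=> t; rewrite /= in_itv/= => /andP[t1 t2]; apply: ie.
    have ee : e / 4 < e by move: e0; lra.
    by rewrite ltr_norml (lt_trans t2)// (lt_trans _ t1)// ltrN2.
  - by move=> t w _ _; have [] := dexp t w.
  - by move=> w; rewrite mulr_ge0 ?expR_ge0// divr_ge0// ltW.
  - exact: iG.
  - move=> t w; rewrite /= in_itv/= => /andP[t1 t2] _.
    rewrite partial1of2E; have [_ ->] := dexp t w.
    by rewrite ger0_norm ?G_bound// mulr_ge0 ?expR_ge0// ltW.
(* The derivative is defined as a [lim], so the convergence just proved identifies its value. *)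
have -> : M^`()%classic 0 =
    \int[P]_(w in setT) partial1of2 (fun t w => expR (t * r w)) 0 w.
  exact: cvg_lim cM.
apply: cvg_trans (cvg_dnbhs_at_right cM); apply: near_eq_cvg.
by near=> h; rewrite addr0 -mmt_gen_fun0.
Unshelve. all: end_near. Qed.
End mmt_gen_nonneg.

(** * Divergence bounds for the mechanism *)

Lemma le_sensitivity (R : realType) (D : Type) (adj : D -> D -> Prop)
    (q : D -> R) (s : R) (x y : D) :
  sensitivity adj q = s%:E -> adj x y -> `|q x - q y| <= s.
Proof.
move=> qs xy; rewrite -lee_fin -qs; apply: ereal_sup_ubound.
by exists x, y.
Qed.

Lemma r2dp_densityE d (T : measurableType d) (R : realType) (P : probability T R)
    (b : T -> R) (a x : R) :
  r2dp_density P b a x = laplace_mixture P (fun w => (b w)^-1) a x.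
Proof.
rewrite /r2dp_density /laplace_mixture; congr fine.
apply: eq_integral => w _; rewrite /laplace_pdf invfM mulrC [2^-1 * _]mulrC.
by rewrite [in RHS]mulrC [_^-1 * `|_|]mulrC.
Qed.

Lemma renyi_div_laplace_mixture_le d (T : measurableType d) (R : realType)
    (P : probability T R) (r : T -> R) (al a c : R) :
  measurable_fun setT r -> (forall w, 0 < r w) ->
  P.-integrable setT (EFin \o r) ->
  1 < al -> `|a - c| <= 1 ->
  P.-integrable setT (fun w => (expR ((al - 1) * r w))%:E) ->
  (renyi_div al (laplace_mixture P r a) (laplace_mixture P r c) <=
   ((al - 1)^-1 * ln ((al * fine ('M_P r (al - 1)) +
      (al - 1) * fine ('M_P r (- al))) / (2 * al - 1)))%:E)%E.
Proof.
move=> mr r0 ir al1 ac ial.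
have := integral_powR_laplace_mixture_le mr r0 ir (ltW al1) ac.
rewrite (integral_laplace_renyi_moment mr r0 (ltW al1) ial) /renyi_div.
(* The value +oo contradicts the real upper bound, and a nonpositive integral gives divergence
   -oo. *)
case: (\int[_]_x _)%E => [s| |]; rewrite ?leye_eq// ?leNye//.
rewrite lee_fin => sle; case: ifPn => [s0|_]; last exact: leNye.
rewrite lee_fin; apply: ler_wpM2l; first by rewrite invr_ge0 subr_ge0 ltW.
by rewrite ler_ln ?posrE// (lt_le_trans s0).
Qed.

Lemma kl_div_laplace_mixture_mmt_gen_le d (T : measurableType d) (R : realType)
    (P : probability T R) (r : T -> R) (e a c : R) :
  measurable_fun setT r -> (forall w, 0 < r w) -> 0 < e ->
  (forall t, `|t| < e -> P.-integrable setT (fun w => (expR (t * r w))%:E)) ->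
  `|a - c| <= 1 ->
  (kl_div (laplace_mixture P r a) (laplace_mixture P r c) <=
   ((fun t => fine ('M_P r t))^`()%classic 0 + fine ('M_P r (- 1)) - 1)%:E)%E.
Proof.
move=> mr r0 e0 ie ac.
have ir := mmt_gen_integrable mr r0 e0 ie.
pose M t := fine ('M_P r t).
(* The bound at order 1 + h, with M(-(1 + h)) enlarged to M(-1), so that [h] enters only through the
   difference quotient and continuous factors. *)
pose Q h := ((1 + h) * (h^-1 * (M h - 1)) + (M (- 1) - 1)) / (1 + 2 * h).
have klQ h : 0 < h < e ->
    (kl_div (laplace_mixture P r a) (laplace_mixture P r c) <= (Q h)%:E)%E.
  move=> /andP[h0 he]; have h1 : 1 < 1 + h by lra.
  have iMh : P.-integrable setT (fun w => (expR ((1 + h - 1) * r w))%:E).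
    by rewrite (_ : 1 + h - 1 = h); [apply: ie; rewrite gtr0_norm|ring].
  have := integral_powR_laplace_mixture_le mr r0 ir (ltW h1) ac.
  rewrite (integral_laplace_renyi_moment mr r0 (ltW h1) iMh) => le1.
  apply: le_trans (kl_div_laplace_mixture_le mr r0 ir h1 (le_lt_trans le1 (ltry _))) _.
  apply: (@le_trans _ _ ((1 + h - 1)^-1%:E * (((1 + h) * M (1 + h - 1) +
    (1 + h - 1) * M (- (1 + h))) / (2 * (1 + h) - 1) - 1)%:E)%E).
    apply: lee_wpmul2l; first by rewrite lee_fin invr_ge0; lra.
    by rewrite EFinB leeB.
  rewrite -EFinM lee_fin (_ : 1 + h - 1 = h); last by ring.
  have M1 : M (- (1 + h)) <= M (- 1).
    apply: mmt_gen_fun_le => //; first by lra.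
    by apply: integrable_expR_le (integrable_expR0 P r) => //; lra.
  have -> : h^-1 * (((1 + h) * M h + h * M (- (1 + h))) / (2 * (1 + h) - 1) - 1) =
    ((1 + h) * (h^-1 * (M h - 1)) + (M (- (1 + h)) - 1)) / (1 + 2 * h).
    by field; apply/andP; split; rewrite gt_eqF//; lra.
  by rewrite /Q ler_wpM2r ?lerD2l ?lerD2r// invr_ge0; lra.
have cQ : Q h @[h --> 0^'+] --> (M^`()%classic 0 + M (- 1) - 1).
  have -> : M^`()%classic 0 + M (- 1) - 1 =
    ((1 + 0) * (M^`()%classic 0) + (M (- 1) - 1)) * (1 + 2 * 0)^-1 by field.
  have ch : h @[h --> (0 : R)^'+] --> (0 : R) by apply: cvg_at_right_filter.
  apply: cvgM; last first.
    apply: cvgV; first by rewrite mulr0 addr0 oner_neq0.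
    by apply: cvgD; [exact: cvg_cst|apply: cvgMl_tmp].
  apply: cvgD; last exact: cvg_cst.
  apply: cvgM; first by apply: cvgD => //; exact: cvg_cst.
  exact (cvg_mmt_gen_quotient r0 e0 ie).
have eh : \forall h \near (0 : R)^'+, 0 < h < e.
  near=> h; apply/andP; split => //.
(* A finite divergence lies below [Q h] for all small h > 0, hence below the limit; +oo is excluded
   by h = e / 2. *)
move: klQ; case: (kl_div _ _) => [k| |] klQ; last exact: leNye.
- rewrite lee_fin; apply: (cvgr_to_ge cQ).
  by apply: filterS eh => h /klQ; rewrite lee_fin.
- have : (+oo <= (Q (e / 2))%:E :> \bar R)%E by apply: klQ; apply/andP; split; lra.
  by rewrite leye_eq.
Unshelve. all: end_near. Qed.

Theorem theoremF3 (R : realType) (dT : measure_display) (T : measurableType dT)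
  (P : probability T R) (b : {RV P >-> R})
  (D : Type) (adj : D -> D -> Prop) (q : D -> R) :
  (forall w, 0 < b w) ->
  (* 1/b has a moment generating function: E[exp(t/b)] < oo near t = 0 *)
  (exists2 e : R, 0 < e & forall t, `|t| < e ->
      P.-integrable setT (fun w => (expR (t * (b w)^-1))%:E)) ->
  sensitivity adj q = 1%:E ->
  let M := fun t : R => fine ('M_P (fun w => (b w)^-1) t) in
  let Mq := fun d => r2dp_density P b (q d) in
  (forall alpha : R, 1 < alpha ->
     P.-integrable setT (fun w => (expR ((alpha - 1) * (b w)^-1))%:E) ->
     RDP adj Mq alpha
       ((alpha - 1)^-1 * ln ((alpha * M (alpha - 1) + (alpha - 1) * M (- alpha))
                              / (2 * alpha - 1))))
  /\ RDP adj Mq 1 (derive1 M 0 + M (-1) - 1).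
Proof.
move=> b0 [e e0 ie] sq M Mq.
pose r w := (b w)^-1.
have r0 w : 0 < r w by rewrite invr_gt0.
have mr : measurable_fun setT r.
  (* Measurability of the inverse comes from that of the power -1, which agrees with it because b >
     0. *)
  rewrite (_ : r = fun w => b w `^ (- 1)); last first.
    by apply/funext => w; rewrite powR_inv1// ltW.
  by apply: (measurableT_comp (measurable_powR (- 1))).
have MqE x : Mq x = laplace_mixture P r (q x).
  by apply/funext => y; exact: r2dp_densityE.
split=> [alpha alpha1 ialpha|] x y xy; rewrite /rdiv !MqE.
- rewrite gt_eqF//; have ir := mmt_gen_integrable mr r0 e0 ie.
  exact: (renyi_div_laplace_mixture_le mr r0 ir alpha1 (le_sensitivity sq xy)).
- rewrite eqxx; apply: kl_div_laplace_mixture_mmt_gen_le mr r0 e0 ie _.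
  exact: le_sensitivity sq xy.
Qed.
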